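(* Let $X$ be an affine variety over $\mathbb{C}$ with finite Picard group. If $\mathrm{ML}(X)\cong\mathbb{C}$ (i.e. $\mathrm{ML}(X)$ consists of constants only), then $\mathrm{FD}(X)=\mathbb{C}(X)$.
   Context: Let $X$ be an affine variety over $\mathbb{C}$ with coordinate ring $\mathbb{C}[X]$ and field of rational functions $\mathbb{C}(X)$. A derivation $\delta$ of $\mathbb{C}[X]$ is locally nilpotent if for every $f\in\mathbb{C}[X]$ there is an integer $k\ge 0$ with $\delta^k(f)=0$; $\mathrm{LND}(X)$ denotes the set of all locally nilpotent derivations of $\mathbb{C}[X]$. The Makar-Limanov invariant is the subring $\mathrm{ML}(X)=\bigcap_{\delta\in\mathrm{LND}(X)}\ker\delta$ of $\mathbb{C}[X]$. The field Derksen invariant $\mathrm{FD}(X)$ is the subfield of $\mathbb{C}(X)$ generated by the kernels $\ker\delta\subset\mathbb{C}(X)$, where $\delta$ runs over all non-trivial (i.e. non-zero) locally nilpotent derivations of $\mathbb{C}[X]$, each extended to a derivation of $\mathbb{C}(X)$.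
   Formalization: X is assumed not isomorphic to the affine line, where the claim fails: Pic is trivial and ML = C, but FD(A^1) = C, not C(x). Subfields of C(X) are taken to contain C, which matters only when X is a point. *)

(* Defs.v *)
From HB Require Import structures.
From mathcomp Require Import all_boot all_order all_algebra.
From mathcomp Require Import boolp classical_sets reals.
From mathcomp Require Import complex mpoly ring.

Set Implicit Arguments.
Unset Strict Implicit.
Unset Printing Implicit Defensive.

Import GRing.Theory.

Local Open Scope classical_set_scope.
Local Open Scope ring_scope.
Local Open Scope quotient_scope.

#[short(type="domainAlgType")]
HB.structure Definition DomainAlgebra (K : comNzRingType) :=
  {A of GRing.IntegralDomain A & GRing.ComAlgebra K A}.

Notation tofrac := (@FracField.tofrac _).

Section LocallyNilpotentDerivations.
Variables (K : comNzRingType) (A : domainAlgType K).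
Implicit Types (d : {linear A -> A}) (f g : A) (x y : {fraction A}).

Definition derivation d : Prop := forall f g, d (f * g) = d f * g + f * d g.

Definition locally_nilpotent d : Prop := forall f, exists k, iter k d f = 0.

Definition LND : set {linear A -> A} :=
  [set d | derivation d /\ locally_nilpotent d].

Definition Makar_Limanov : set A := \bigcap_(d in LND) [set f | d f = 0].

Definition constants : set A := range (fun c : K => c%:A).

(* The extension of d to the fraction field, given by the quotient rule
   applied to the representative of the fraction chosen by repr; it does not
   depend on this choice, see frac_derE. *)
Definition frac_der d x : {fraction A} :=
  let a := \n_(repr x) in let b := \d_(repr x) in
  tofrac (d a * b - a * d b) / tofrac (b ^+ 2).

Definition frac_ker d : set {fraction A} := [set x | frac_der d x = 0].

Definition subfield (F : set {fraction A}) : Prop :=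
  [/\ F 1, forall x y, F x -> F y -> F (x - y)
         & forall x y, F x -> F y -> F (x / y)].

(* Subfields of the function field are taken over the base field: the
   generated field contains K even when A has no nonzero locally nilpotent
   derivation.  Otherwise K already lies in every kernel. *)
Definition field_Derksen : set {fraction A} :=
  smallest subfield
    (tofrac @` constants `|`
     \bigcup_(d in [set d | LND d /\ exists f, d f != 0]) frac_ker d).

Lemma tofrac_neq0 f : (tofrac f != 0) = (f != 0).
Proof. by rewrite tofrac_eq0. Qed.

Lemma frac_repr x : x = tofrac \n_(repr x) / tofrac \d_(repr x).
Proof.
suff P (r : {ratio A}) : \pi_{fraction A} r = tofrac \n_r / tofrac \d_r.
  by rewrite -P reprK.
have nz : tofrac \d_r != 0 by rewrite tofrac_neq0; exact: denom_ratioP.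
apply: (mulIf nz); rewrite mulfVK //; unlock FracField.tofrac.
rewrite -[LHS]FracField.pi_mul; apply/eqmodP => /=.
by rewrite FracField.equivfE /FracField.mulf
           !numden_Ratio ?mulr1 ?oner_neq0 ?denom_ratioP // mulrC.
Qed.

Lemma frac_derE d f g : derivation d -> g != 0 ->
  frac_der d (tofrac f / tofrac g) =
  tofrac (d f * g - f * d g) / tofrac (g ^+ 2).
Proof.
move=> dd g0; rewrite /frac_der.
set x := tofrac f / tofrac g.
set a := \n_(repr x); set b := \d_(repr x).
have b0 : b != 0 by exact: denom_ratioP.
have E : f * b = a * g.
  have := frac_repr x; rewrite -/a -/b {1}/x => /eqP.
  by rewrite eqr_div ?tofrac_neq0 // -!tofracM tofrac_eq => /eqP.
apply/eqP; rewrite eqr_div ?tofrac_neq0 ?expf_neq0 // -!tofracM tofrac_eq.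
have D : d f * b + f * d b = d a * g + a * d g by rewrite -!dd E.
have D' : d a * g = d f * b + f * d b - a * d g by rewrite D addrK.
apply/eqP.
have -> : (d a * b - a * d b) * g ^+ 2
          = b * g * (d a * g) - (a * g) * (g * d b) by ring.
rewrite D'.
have -> : b * g * (d f * b + f * d b - a * d g)
          = b * g * (d f * b + f * d b) - (a * g) * (b * d g) by ring.
by rewrite -E; ring.
Qed.

Lemma frac_der_tofrac d f : derivation d ->
  frac_der d (tofrac f) = tofrac (d f).
Proof.
move=> dd; have d1 : d 1 = 0.
  have := dd 1 1; rewrite !mulr1 mul1r => /eqP.
  by rewrite -subr_eq subrr eq_sym => /eqP.
have := @frac_derE d f 1 dd (oner_neq0 _).
by rewrite !tofrac1 divr1 d1 mulr0 subr0 mulr1 expr1n tofrac1 divr1.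
Qed.

End LocallyNilpotentDerivations.

Arguments LND {K} A _.
Arguments Makar_Limanov {K} A _.
Arguments constants {K} A _.
Arguments field_Derksen {K} A _.

Section Picard.
Variable A : comNzRingType.

Definition isomorphic_modules (M N : lmodType A) : Prop :=
  exists h : {linear M -> N}, bijective h.

Definition is_tensor_product (M N T : lmodType A)
    (b : {bilinear M -> N -> T}) : Prop :=
  forall (P : lmodType A) (c : {bilinear M -> N -> P}),
    (exists h : {linear T -> P}, forall x y, h (b x y) = c x y) /\
    (forall h h' : {linear T -> P},
       (forall x y, h (b x y) = h' (b x y)) -> h =1 h').

Definition invertible_module (M : lmodType A) : Prop :=
  exists (N : lmodType A) (b : {bilinear M -> N -> A^o}), is_tensor_product b.

(* The Picard group of A is the set of isomorphism classes of invertible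
   A-modules, with the tensor product as group law; it is finite when finitely
   many invertible modules represent all the classes.  (These classes do not
   form a [set (lmodType A)] for universe reasons.) *)
Definition finite_Picard : Prop :=
  exists (r : nat) (L : 'I_r -> lmodType A),
    (forall i, invertible_module (L i)) /\
    (forall M, invertible_module M -> exists i, isomorphic_modules M (L i)).

End Picard.

Section AffineVarieties.
Variable K : fieldType.

Definition zero_locus n (S : set {mpoly K[n]}) : set ('I_n -> K) :=
  [set x | forall p, S p -> p.@[x] = 0].

Definition zariski_closed n (X : set ('I_n -> K)) : Prop :=
  exists S : set {mpoly K[n]}, X = zero_locus S.

Definition zariski_irreducible n (X : set ('I_n -> K)) : Prop :=
  X !=set0 /\
  forall Y Z : set ('I_n -> K), zariski_closed Y -> zariski_closed Z ->
    X = Y `|` Z -> X = Y \/ X = Z.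

Record affine_variety := AffineVariety {
  ambient_dim : nat;
  points : set ('I_ambient_dim -> K);
  points_closed : zariski_closed points;
  points_irreducible : zariski_irreducible points
}.
Arguments points : clear implicits.

Definition vanishing_ideal (X : affine_variety) :
    {mpoly K[ambient_dim X]} -> bool :=
  fun p => `[< forall x, points X x -> p.@[x] = 0 >].
Arguments vanishing_ideal : clear implicits.

Lemma vanishing_idealP (X : affine_variety) p :
  reflect (forall x, points X x -> p.@[x] = 0) (p \in vanishing_ideal X).
Proof. exact: asboolP. Qed.

Lemma vanishing_ideal_closed (X : affine_variety) :
  idealr_closed (vanishing_ideal X).
Proof.
split.
- by apply/vanishing_idealP => x _; rewrite meval0.
- have [[x Xx] _] := points_irreducible X.
  apply/negP => /vanishing_idealP /(_ _ Xx) /eqP.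
  by rewrite meval1 oner_eq0.
move=> a u v /vanishing_idealP u0 /vanishing_idealP v0.
apply/vanishing_idealP => x Xx.
by rewrite mevalD mevalM u0 // v0 // mulr0 addr0.
Qed.

HB.instance Definition _ (X : affine_variety) :=
  isIdealr.Build {mpoly K[ambient_dim X]} (vanishing_ideal X)
    (vanishing_ideal_closed X).

Lemma vanishing_ideal_prime (X : affine_variety) :
  prime_idealr_closed (vanishing_ideal X).
Proof.
move=> u v /vanishing_idealP uv0.
have [S XS] := points_closed X.
have [_ irrX] := points_irreducible X.
pose cut p := [set x | points X x /\ p.@[x] = 0].
have cut_closed p : zariski_closed (cut p).
  exists (p |` S); apply/seteqP; split => x.
    by move=> [Xx px] q [-> //|]; move: Xx; rewrite XS; apply.
  by move=> h; split; [rewrite XS => q Sq; apply: h; right | apply: h; left].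
have XE : points X = cut u `|` cut v.
  apply/seteqP; split => [x Xx|x [[]|[]]//].
  have /eqP := uv0 x Xx; rewrite mevalM mulf_eq0.
  by case/orP => /eqP ?; [left | right].
case: (irrX _ _ (cut_closed u) (cut_closed v) XE) => XE'; apply/orP.
- by left; apply/vanishing_idealP => x; rewrite XE' => -[].
- by right; apply/vanishing_idealP => x; rewrite XE' => -[].
Qed.

HB.instance Definition _ (X : affine_variety) :=
  isPrimeIdealrClosed.Build {mpoly K[ambient_dim X]} (vanishing_ideal X)
    (@vanishing_ideal_prime X).

Definition vanishing_prime (X : affine_variety) :
    prime_idealr {mpoly K[ambient_dim X]} :=
  [the prime_idealr _ of vanishing_ideal X].

Section CoordinateRing.
Variable X : affine_variety.

Definition coord_ring : Type := {ideal_quot (vanishing_prime X)}.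

HB.instance Definition _ := GRing.ComNzRing.on coord_ring.

Definition restriction (p : {mpoly K[ambient_dim X]}) : coord_ring :=
  \pi_{ideal_quot (vanishing_prime X)} p.

Lemma restriction_is_zmod_morphism : zmod_morphism restriction.
Proof. exact: raddfB. Qed.

Lemma restriction_is_monoid_morphism : monoid_morphism restriction.
Proof. by split; [exact: rmorph1 | exact: rmorphM]. Qed.

HB.instance Definition _ := GRing.isZmodMorphism.Build
  {mpoly K[ambient_dim X]} coord_ring restriction restriction_is_zmod_morphism.
HB.instance Definition _ := GRing.isMonoidMorphism.Build
  {mpoly K[ambient_dim X]} coord_ring restriction
  restriction_is_monoid_morphism.

Implicit Types f g : coord_ring.

Definition coord_unit : {pred coord_ring} :=
  fun f => `[< exists g, g * f = 1 >].

Definition coord_inv f : coord_ring :=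
  if pselect (exists g, g * f = 1) is left h then projT1 (cid h) else f.

Lemma coord_mulVf : {in coord_unit, left_inverse 1 coord_inv *%R}.
Proof.
move=> f /asboolP fu; rewrite /coord_inv.
by case: pselect => // h; case: (cid h).
Qed.

Lemma coord_unitP f g : g * f = 1 -> coord_unit f.
Proof. by move=> gf; apply/asboolP; exists g. Qed.

Lemma coord_inv_out : {in [predC coord_unit], coord_inv =1 id}.
Proof.
move=> f /negP fu; rewrite /coord_inv; case: pselect => // h.
by case: fu; apply/asboolP.
Qed.

HB.instance Definition _ := GRing.ComNzRing_hasMulInverse.Build coord_ring
  coord_mulVf coord_unitP coord_inv_out.

HB.instance Definition _ :=
  GRing.ComUnitRing_isIntegral.Build coord_ring
    (@Quotient.rquot_IdomainAxiom _ (vanishing_prime X)).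

Definition coord_scale (c : K) f : coord_ring := restriction c%:MP * f.

Lemma coord_scaleA a b f : coord_scale a (coord_scale b f) = coord_scale (a * b) f.
Proof. by rewrite /coord_scale mpolyCM rmorphM mulrA. Qed.

Lemma coord_scale1 : left_id 1 coord_scale.
Proof. by move=> f; rewrite /coord_scale mpolyC1 rmorph1 mul1r. Qed.

Lemma coord_scaleDr : right_distributive coord_scale +%R.
Proof. by move=> c f g; rewrite /coord_scale mulrDr. Qed.

Lemma coord_scaleDl f : {morph coord_scale^~ f : a b / a + b}.
Proof. by move=> a b; rewrite /coord_scale mpolyCD rmorphD mulrDl. Qed.

HB.instance Definition _ := GRing.Zmodule_isLmodule.Build K coord_ring
  coord_scaleA coord_scale1 coord_scaleDr coord_scaleDl.

Lemma coord_scaleAl (c : K) f g : c *: (f * g) = (c *: f) * g.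
Proof. exact: mulrA. Qed.

HB.instance Definition _ :=
  GRing.Lmodule_isLalgebra.Build K coord_ring coord_scaleAl.

HB.instance Definition _ := GRing.Lalgebra_isComAlgebra.Build K coord_ring.

End CoordinateRing.

(* On the affine line the nonzero locally nilpotent derivations are the c d/dx
   with c a nonzero constant (in characteristic 0); both their kernel in K(x)
   and the Makar-Limanov invariant are K, so field_Derksen is K, not K(x). *)
Definition isomorphic_to_line (X : affine_variety) : Prop :=
  exists h : {lrmorphism {poly K} -> coord_ring X}, bijective h.

End AffineVarieties.

Arguments points {K} _ _.
Arguments vanishing_ideal {K} _ _.

(* Main.v *)
Require Import Defs.
From HB Require Import structures.
From mathcomp Require Import all_boot all_order all_algebra.
From mathcomp Require Import boolp classical_sets reals.
From mathcomp Require Import complex mpoly ring.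

(** Write A for the coordinate ring and F for a subfield of Frac A that contains
the constants and the kernels of all nonzero locally nilpotent derivations
(LNDs).  The aim is F = Frac A.

The central fact is that a local slice of an LND d, that is an element s with
d s <> 0 and d (d s) = 0, generates A over the kernel of d once d s is inverted
([local_slice_ind]).  Hence it is enough to find one nonzero LND d' with a local
slice in F ([subfield_local_slice]): its kernel lies in F by assumption.

If A has no nonzero LND, then A, being its own Makar-Limanov invariant, consists
of constants.  Otherwise let d be a nonzero LND.  If ker d consists of
constants, then d has a local slice s with d s a nonzero constant, so A is the
polynomial ring in s ([LND_kernel_constants]) and the variety is the affine
line.  If not, some f in ker d is not constant; since the Makar-Limanov
invariant is trivial, some LND d' satisfies d' f <> 0.

The automorphisms exp (k d'), for k in the base field, conjugate d to LNDs
([LND_conj]) whose kernels contain exp (k d') f.  So the values at all k of the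
polynomial with coefficients d'^i f / i! lie in F, and by inverting a
Vandermonde matrix so do its coefficients ([coef_in_subspace]).  Thus F contains
every d'^i f, and the last but one nonzero of these is a local slice of d'. *)

Set Implicit Arguments.
Unset Strict Implicit.
Unset Printing Implicit Defensive.

Import GRing.Theory.

Local Open Scope classical_set_scope.
Local Open Scope ring_scope.

(** * Base fields of characteristic zero *)

Section CharacteristicZero.
Variables (K : fieldType) (charK0 : [pchar K] =i pred0).

Lemma natr_eq0_pchar0 n : (n%:R == 0 :> K) = (n == 0)%N.
Proof. exact: (GRing.pcharf0P _).1. Qed.

Lemma factr_neq0 n : n`!%:R != 0 :> K.
Proof. by rewrite natr_eq0_pchar0 -lt0n fact_gt0. Qed.

Lemma inv_fact_bin m n : (m <= n)%N ->
  n`!%:R^-1 * 'C(n, m)%:R = m`!%:R^-1 * (n - m)`!%:R^-1 :> K.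
Proof.
move=> le_mn; rewrite -(bin_fact le_mn) !natrM.
have m0 := factr_neq0 m; have nm0 := factr_neq0 (n - m).
have b0 : 'C(n, m)%:R != 0 :> K by rewrite natr_eq0_pchar0 -lt0n bin_gt0.
by field; rewrite m0 nm0 b0.
Qed.

Lemma natr_inj : injective (fun n : nat => n%:R : K).
Proof.
move=> m n; wlog le_mn : m n / (m <= n)%N => [W E|/esym/eqP].
  by case/orP: (leq_total m n) => /W; [|move=> W'; symmetry]; auto.
rewrite -subr_eq0 -natrB // natr_eq0_pchar0 subn_eq0 => le_nm.
by apply/eqP; rewrite eqn_leq le_mn.
Qed.

(** The base field is infinite, so a vector-valued polynomial function can be
evaluated at as many distinct points as it has coefficients; the inverse of the
Vandermonde matrix expresses the coefficients in terms of the values. *)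
Lemma coef_in_subspace (M : lmodType K) (P : M -> Prop) n (v : 'I_n -> M) :
    P 0 -> (forall k x y, P x -> P y -> P (k *: x + y)) ->
    (forall k, P (\sum_(i < n) k ^+ i *: v i)) ->
  forall i, P (v i).
Proof.
move=> P0 Plin Pv m.
(* Characteristic zero makes the n points 0, ..., n - 1 distinct. *)
pose W := Vandermonde n (\row_(j < n) (j%:R : K)).
have Wu : W \in unitmx.
  rewrite unitmxE det_Vandermonde unitfE; apply/prodf_neq0 => i _.
  apply/prodf_neq0 => j ltij; rewrite !mxE subr_eq0.
  by apply: contraTneq ltij => /natr_inj ->; rewrite ltnn.
have -> : v m = \sum_j invmx W j m *: \sum_(i < n) j%:R ^+ i *: v i.
  under eq_bigr => j _ do rewrite scaler_sumr.
  rewrite exchange_big /=.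
  have E (i : 'I_n) : \sum_(j < n) invmx W j m *: (j%:R ^+ i *: v i)
                      = (1%:M : 'M[K]_n) i m *: v i.
    rewrite -(mulmxV Wu) mxE scaler_suml; apply: eq_bigr => j _.
    by rewrite !mxE scalerA mulrC.
  under eq_bigr => i _ do rewrite E mxE.
  rewrite (bigD1 m) //= eqxx scale1r big1 ?addr0 // => i /negPf ->.
  by rewrite scale0r.
apply: big_ind => //.
  by move=> x y Px Py; rewrite -[x]scale1r; apply: Plin.
by move=> j _; rewrite -[_ *: _]addr0; apply: Plin.
Qed.

End CharacteristicZero.

(** * Iterates of a derivation *)

Lemma pascal_sum (V : nmodType) (F : nat -> V) n :
  \sum_(i < n.+2) F i *+ 'C(n.+1, i) =
  \sum_(i < n.+1) (F i + F i.+1) *+ 'C(n, i).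
Proof.
under [RHS]eq_bigr => i _ do rewrite mulrnDl.
rewrite big_split big_ord_recl /=.
under [X in _ + X = _]eq_bigr => i _ do rewrite /bump add1n binS mulrnDr.
rewrite big_split /= addrA; congr (_ + _).
rewrite [RHS]big_ord_recl !bin0 /=; congr (_ + _).
by rewrite big_ord_recr /= (bin_small (ltnSn n)) mulr0n addr0.
Qed.

Section Derivations.
Variables (K : fieldType) (A : domainAlgType K).
Implicit Types (d : {linear A -> A}) (a b c f s : A) (k : K).

Lemma der1 d : derivation d -> d 1 = 0.
Proof.
move=> dd; have := dd 1 1.
by rewrite !mulr1 mul1r => /eqP; rewrite addrC -subr_eq subrr => /eqP.
Qed.

Lemma der_const d k : derivation d -> d k%:A = 0.
Proof. by move=> dd; rewrite linearZ /= der1 // scaler0. Qed.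

Lemma iter_linearP d n k a b :
  iter n d (k *: a + b) = k *: iter n d a + iter n d b.
Proof. by elim: n => //= n ->; rewrite linearP. Qed.

Lemma iter_linear0 d n : iter n d 0 = 0.
Proof. by elim: n => //= n ->; rewrite linear0. Qed.

Lemma iter_linearZ d n k a : iter n d (k *: a) = k *: iter n d a.
Proof. by rewrite -[k *: a]addr0 iter_linearP iter_linear0 addr0. Qed.

Lemma iter_linear_ge d m n a : (m <= n)%N -> iter m d a = 0 -> iter n d a = 0.
Proof. by move=> /subnK <- a0; rewrite iterD a0 iter_linear0. Qed.

Lemma der_Leibniz d n a b : derivation d ->
  iter n d (a * b) =
  \sum_(i < n.+1) (iter i d a * iter (n - i) d b) *+ 'C(n, i).
Proof.
move=> dd; elim: n => [|n IH]; first by rewrite big_ord1.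
rewrite (pascal_sum (fun i => iter i d a * iter (n.+1 - i) d b)).
rewrite iterS IH linear_sum /=; apply: eq_bigr => i _.
by rewrite raddfMn /= dd addrC subSS subSn // -ltnS.
Qed.

Lemma iter_derMl d n c a : derivation d -> d c = 0 ->
  iter n d (c * a) = c * iter n d a.
Proof. by move=> dd dc; elim: n => //= n ->; rewrite dd dc mul0r add0r. Qed.

Lemma der_exp d n a : derivation d -> d (a ^+ n.+1) = n.+1%:R *: (d a * a ^+ n).
Proof.
move=> dd; elim: n => [|n IH]; first by rewrite scale1r expr1 mulr1.
rewrite exprS dd IH [in RHS]mulrSr scalerDl scale1r addrC; congr (_ + _).
by rewrite -scalerAr exprS mulrCA.
Qed.

Lemma iter_der_exp d n s : derivation d -> d (d s) = 0 ->
  iter n d (s ^+ n) = n`!%:R *: d s ^+ n.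
Proof.
move=> dd dds; elim: n => [|n IH]; first by rewrite scale1r.
rewrite iterSr der_exp // iter_linearZ iter_derMl // IH.
by rewrite -scalerAr -exprS scalerA -natrM -factS.
Qed.

(** A local slice is the last but one nonzero iterate. *)
Lemma local_slice d f : locally_nilpotent d -> d f != 0 ->
  exists n, d (iter n d f) != 0 /\ d (d (iter n d f)) = 0.
Proof.
move=> nil df0; have [N fN] := nil f.
have ex : exists m, iter m d f == 0 by exists N; apply/eqP.
case: (ex_minnP ex) => -[|[|m]] /eqP /= f0 minf.
- by rewrite f0 linear0 eqxx in df0.
- by rewrite f0 eqxx in df0.
exists m; split=> //; apply/negP => /(minf m.+1).
by rewrite ltnn.
Qed.

(** * The one-parameter group of a locally nilpotent derivation *)

Section Exponential.
Variables (charK0 : [pchar K] =i pred0).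
Variables (d : {linear A -> A}) (dd : derivation d) (nil : locally_nilpotent d).

Definition divided_der n a : A := n`!%:R^-1 *: iter n d a.

(** This is exp (t d) a as a polynomial in the parameter t; the laws of the
one-parameter group then become statements about coefficients. *)
Definition exp_poly a : {poly A} :=
  \poly_(i < projT1 (cid (nil a))) divided_der i a.

Definition exp_der k a : A := (exp_poly a).[k%:A].

Lemma coef_exp_poly a i : (exp_poly a)`_i = divided_der i a.
Proof.
rewrite coef_poly; case: cid => N /= aN; case: ltnP => // leNi.
by rewrite /divided_der (iter_linear_ge leNi aN) scaler0.
Qed.

Lemma exp_poly_is_linear k a b :
  exp_poly (k *: a + b) = k%:A *: exp_poly a + exp_poly b.
Proof.
apply/polyP => i; rewrite coefD coefZ !coef_exp_poly /divided_der.
by rewrite iter_linearP scalerDr mulr_algl !scalerA mulrC.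
Qed.

Lemma exp_polyM a b : exp_poly (a * b) = exp_poly a * exp_poly b.
Proof.
apply/polyP => n; rewrite coefM coef_exp_poly /divided_der der_Leibniz //.
rewrite scaler_sumr; apply: eq_bigr => i _.
rewrite !coef_exp_poly /divided_der -scalerAl -scalerAr -scaler_nat !scalerA.
by rewrite inv_fact_bin // -ltnS.
Qed.

Lemma exp_der_is_linear k : linear (exp_der k).
Proof.
by move=> x a b; rewrite /exp_der exp_poly_is_linear hornerD hornerZ mulr_algl.
Qed.

HB.instance Definition _ k :=
  GRing.isLinear.Build K A A *:%R (exp_der k) (exp_der_is_linear k).

Lemma exp_derM k a b : exp_der k (a * b) = exp_der k a * exp_der k b.
Proof. by rewrite /exp_der exp_polyM hornerM. Qed.

Lemma exp_der0 a : exp_der 0 a = a.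
Proof.
rewrite /exp_der scale0r horner_coef0 coef_exp_poly /divided_der.
by rewrite invr1 scale1r.
Qed.

(** The divided derivatives in the parameter t are those along d, so that the
Taylor expansion in t yields the group law [exp_derD]. *)
Lemma nderivn_exp_poly n a : (exp_poly a)^`N(n) = exp_poly (divided_der n a).
Proof.
apply/polyP => i; rewrite coef_nderivn !coef_exp_poly /divided_der.
rewrite iter_linearZ -iterD addnC -scaler_nat !scalerA mulrC.
by rewrite inv_fact_bin ?leq_addl // addnK mulrC.
Qed.

Lemma exp_derE k a :
  exp_der k a = \sum_(i < size (exp_poly a)) k ^+ i *: divided_der i a.
Proof.
rewrite /exp_der horner_coef; apply: eq_bigr => i _.
by rewrite coef_exp_poly exprZn expr1n -scalerAr mulr1.
Qed.

Lemma exp_derD k l a : exp_der (k + l) a = exp_der k (exp_der l a).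
Proof.
rewrite [exp_der l a]exp_derE linear_sum {1}/exp_der scalerDl.
rewrite nderiv_taylor; last exact: mulrC.
apply: eq_bigr => i _.
by rewrite nderivn_exp_poly linearZ exprZn expr1n -scalerAr mulr1.
Qed.

Lemma exp_derK k : cancel (exp_der k) (exp_der (- k)).
Proof. by move=> a; rewrite -exp_derD addNr exp_der0. Qed.

Lemma LND_conj k (d' : {linear A -> A}) :
  LND A d' -> LND A (exp_der k \o d' \o exp_der (- k)).
Proof.
move=> [dd' nil']; have E := exp_derK k.
have EN : cancel (exp_der (- k)) (exp_der k).
  by move=> a; rewrite -{1}[k]opprK exp_derK.
split=> [a b|a] /=; first by rewrite exp_derM dd' linearD /= !exp_derM !EN.
have [n an] := nil' (exp_der (- k) a); exists n.
rewrite (_ : iter n _ a = exp_der k (iter n d' (exp_der (- k) a))).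
  by rewrite an linear0.
by elim: n {an} => /= [|n ->]; rewrite ?EN // E.
Qed.

End Exponential.

(** * Local slices *)

(** Up to a power of d s, every a is a polynomial in s over ker d: if d^N a lies
in ker d, then (d s)^N a and (d^N a / N!) s^N have the same image under d^N, so
induction on N applies to their difference. *)
Lemma local_slice_ind d s (P : A -> Prop) :
    [pchar K] =i pred0 -> LND A d -> d s != 0 -> d (d s) = 0 ->
    (forall a, d a = 0 -> P a) -> P s ->
    (forall a b, P a -> P b -> P (a + b)) ->
    (forall a b, P a -> P b -> P (a * b)) ->
    (forall a, P (d s * a) -> P a) ->
  forall a, P a.
Proof.
move=> charK0 [dd nil] ds0 dds Pker Ps PD PM Pdiv a.
have Pdivn n b : P (d s ^+ n * b) -> P b.
  elim: n => [|n IH]; first by rewrite mul1r.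
  by rewrite exprS -mulrA => /Pdiv.
have PX n : P (s ^+ n).
  by elim: n => [|n IH]; [apply: Pker; exact: der1 | rewrite exprS; apply: PM].
have dX n : d (d s ^+ n) = 0.
  by case: n => [|n]; [exact: der1 | rewrite der_exp // dds mul0r scaler0].
have [N] := nil a; elim: N a => [|N IH] a aN.
  by apply: Pker; rewrite -[a]/(iter 0 d a) aN linear0.
pose e := N`!%:R^-1 *: iter N d a.
have de : d e = 0 by rewrite linearZ /= -iterS aN scaler0.
apply: (Pdivn N); rewrite -[_ * a](subrK (e * s ^+ N)).
apply: PD; last by apply: PM => //; exact: Pker.
apply: IH; rewrite addrC -scaleN1r iter_linearP !iter_derMl // iter_der_exp //.
rewrite scaleN1r /e -scalerAl -scalerAr scalerA mulVf ?factr_neq0 // scale1r.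
by rewrite mulrC addNr.
Qed.

(** [horner_alg] is linear for k acting on A as multiplication by k%:A; an
isomorphism of K-algebras has to be linear for the scaling of A itself. *)
Definition alg_eval s : {poly K} -> A := horner_alg s.

HB.instance Definition _ s := GRing.RMorphism.on (alg_eval s).

Lemma alg_evalC s k : alg_eval s k%:P = k%:A.
Proof. exact: horner_algC. Qed.

Lemma alg_evalX s : alg_eval s 'X = s.
Proof. exact: horner_algX. Qed.

Lemma alg_eval_is_scalable s : scalable (alg_eval s).
Proof.
by move=> k p; rewrite -mul_polyC rmorphM /= alg_evalC mulr_algl.
Qed.

HB.instance Definition _ s :=
  GRing.isScalable.Build K {poly K} A *:%R (alg_eval s)
    (alg_eval_is_scalable s).

Lemma der_alg_eval d s (p : {poly K}) : derivation d ->
  d (alg_eval s p) = alg_eval s p^`() * d s.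
Proof.
move=> dd; elim/poly_ind: p => [|p c IH].
  by rewrite deriv0 rmorph0 linear0 mul0r.
rewrite derivD derivC addr0 derivM derivX mulr1 !rmorphD !rmorphM /=.
rewrite alg_evalX alg_evalC linearD /= der_const // addr0 dd IH mulrDl.
by rewrite mulrAC addrC.
Qed.

(** A local slice s has d s in ker d, here a nonzero constant, so A = K[s].
There is no relation p(s) = 0: applying d gives p'(s) = 0, a relation of
smaller degree. *)
Lemma LND_kernel_constants d f : [pchar K] =i pred0 -> LND A d -> d f != 0 ->
    (forall a, d a = 0 -> constants A a) ->
  exists h : {lrmorphism {poly K} -> A}, bijective h.
Proof.
move=> charK0 LNDd df0 ker_const; have [dd nil] := LNDd.
have [n] := local_slice nil df0; set s := iter n d f => -[ds0 dds].
exists (alg_eval s).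
have [k _ kE] := ker_const _ dds.
have k0 : k != 0 by apply: contraNneq ds0 => k0; rewrite -kE k0 scale0r.
have inj p : alg_eval s p = 0 -> p = 0.
  have [m] := ubnP (size p); elim: m p => // m IH p /ltnSE size_p p0.
  have [->//|pn0] := eqVneq p 0.
  have dp0 : p^`() = 0.
    apply: IH; first exact: leq_trans (lt_size_deriv pn0) size_p.
    have := der_alg_eval s p dd; rewrite p0 linear0 => /esym/eqP.
    by rewrite mulf_eq0 (negPf ds0) orbF => /eqP.
  have pC : p = (p`_0)%:P.
    apply/polyP => -[|i]; rewrite coefC //=.
    have /eqP := congr1 (fun q : {poly K} => q`_i) dp0.
    rewrite coef_deriv coef0 -mulr_natr mulf_eq0.
    rewrite natr_eq0_pchar0 // orbF.
    by move/eqP.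
  move: p0; rewrite pC alg_evalC => /eqP.
  by rewrite scaler_eq0 oner_eq0 orbF => /eqP ->.
have surj a : exists p, alg_eval s p = a.
  apply: (local_slice_ind charK0 LNDd ds0 dds
            (P := fun a => exists p, alg_eval s p = a)).
  - by move=> b /ker_const[c _ <-]; exists c%:P; rewrite alg_evalC.
  - by exists 'X; rewrite alg_evalX.
  - by move=> b c [p <-] [q <-]; exists (p + q); rewrite rmorphD.
  - by move=> b c [p <-] [q <-]; exists (p * q); rewrite rmorphM.
  - move=> b [p pE]; exists (k^-1 *: p).
    by rewrite linearZ /= pE -kE mulr_algl scalerA mulVf // scale1r.
exists (fun a => projT1 (cid (surj a))) => [p|a]; last by case: cid.
case: cid => q /= qE; apply/eqP; rewrite -subr_eq0; apply/eqP/inj.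
by rewrite rmorphB /= qE subrr.
Qed.

(** * The field generated by the kernels *)

Section Subfield.
Variable F : set {fraction A}.
Hypothesis subF : subfield F.

Lemma subfield0 : F 0.
Proof. by have [F1 FB _] := subF; rewrite -(subrr 1); apply: FB. Qed.

Lemma subfieldD x y : F x -> F y -> F (x + y).
Proof.
move=> Fx Fy; have [_ FB _] := subF.
rewrite -[y]opprK; apply: (FB) => //; rewrite -sub0r; apply: FB => //.
exact: subfield0.
Qed.

Lemma subfieldM x y : F x -> F y -> F (x * y).
Proof.
move=> Fx Fy; have [F1 _ FV] := subF.
by rewrite -[y]invrK; apply: (FV) => //; rewrite -div1r; apply: FV.
Qed.

Lemma subfield_setT : (forall a, F (tofrac a)) -> forall x, F x.
Proof.
by move=> FA x; have [_ _ FV] := subF; rewrite (frac_repr x); apply: FV.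
Qed.

Lemma subfield_local_slice d s : [pchar K] =i pred0 ->
    LND A d -> d s != 0 -> d (d s) = 0 ->
    (forall a, d a = 0 -> F (tofrac a)) -> F (tofrac s) ->
  forall x, F x.
Proof.
move=> charK0 LNDd ds0 dds Fker Fs; apply: subfield_setT.
apply: (local_slice_ind charK0 LNDd ds0 dds) => //.
- by move=> a b Fa Fb; rewrite tofracD; apply: subfieldD.
- by move=> a b Fa Fb; rewrite tofracM; apply: subfieldM.
have [_ _ FV] := subF.
move=> a; rewrite tofracM => Fa.
have tds0 : tofrac (d s) != 0 by rewrite tofrac_neq0.
by rewrite -(mulKf tds0 (tofrac a)) mulrC; apply: FV => //; apply: Fker.
Qed.

End Subfield.

Lemma field_Derksen_full : [pchar K] =i pred0 ->
    ~ (exists h : {lrmorphism {poly K} -> A}, bijective h) ->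
    Makar_Limanov A = constants A ->
  field_Derksen A = setT.
Proof.
move=> charK0 not_line MLA; apply/seteqP; split => // x _ F [subF sub].
have Fconst k : F (tofrac k%:A).
  by apply: sub; left; exists k%:A => //; exists k.
have Fker d a : LND A d -> (exists f, d f != 0) -> d a = 0 -> F (tofrac a).
  move=> LNDd d0 da; apply: sub; right; exists d => //.
  by rewrite /frac_ker /= frac_der_tofrac ?da ?tofrac0 //; case: LNDd.
have [|no_LND] := pselect (exists d, LND A d /\ exists f, d f != 0); last first.
  apply: (subfield_setT subF) => a.
  have : constants A a; last by case=> k _ <-.
  rewrite -MLA => d LNDd; apply/eqP/negPn/negP => da.
  by apply: no_LND; exists d; split=> //; exists a.
case=> d [LNDd [g dg0]].
have [f [df fNconst]] : exists f, d f = 0 /\ ~ constants A f.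
  apply: contrapT => H; apply: not_line.
  apply: LND_kernel_constants LNDd dg0 _ => // a da.
  by apply: contrapT => aN; apply: H; exists a.
have [d' [LNDd' d'f0]] : exists d', LND A d' /\ d' f != 0.
  apply: contrapT => H; apply: fNconst; rewrite -MLA => d' LNDd'.
  by apply/eqP/negPn/negP => d'f; apply: H; exists d'.
have [dd' nil'] := LNDd'.
(* The conjugate of d by exp (k d') kills exp (k d') f. *)
have Fexp k : F (tofrac (exp_der nil' k f)).
  apply: Fker (LND_conj charK0 dd' nil' k LNDd) _ _; last first.
    by rewrite /= exp_derK // df linear0.
  exists (exp_der nil' k g); rewrite /= exp_derK //.
  apply: contraNneq dg0 => /(congr1 (exp_der nil' (- k))).
  by rewrite exp_derK // linear0 => ->.
have Fiter n : F (tofrac (iter n d' f)).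
  have := coef_in_subspace charK0 (P := fun a => F (tofrac a))
     (v := fun i : 'I_(size (exp_poly nil' f)) => divided_der d' i f).
  have FZ k a : F (tofrac a) -> F (tofrac (k *: a)).
    by move=> Fa; rewrite -mulr_algl tofracM; apply: subfieldM.
  move=> W.
  suff: F (tofrac (divided_der d' n f)).
    move=> /(FZ n`!%:R); rewrite /divided_der scalerA divff ?scale1r //.
    exact: factr_neq0.
  have [ltn|len] := ltnP n (size (exp_poly nil' f)).
    apply: W (Ordinal ltn) => [|k a b Fa Fb|k].
    - by rewrite tofrac0; apply: subfield0.
    - by rewrite tofracD; apply: subfieldD => //; apply: FZ.
    - by rewrite -exp_derE.
  by rewrite -(coef_exp_poly nil') nth_default // tofrac0; apply: subfield0.
have [n [ds0 dds]] := local_slice nil' d'f0.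
apply: (subfield_local_slice subF charK0 LNDd' ds0 dds) => // a.
by apply: Fker => //; exists f.
Qed.

End Derivations.

Theorem corollary3p9 (R : realType) (X : affine_variety R[i]) :
  finite_Picard (coord_ring X) ->
  ~ isomorphic_to_line X ->
  Makar_Limanov (coord_ring X) = constants (coord_ring X) ->
  field_Derksen (coord_ring X) = setT.
Proof. by move=> _; apply: field_Derksen_full; exact: Num.Theory.pchar_num. Qed.
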